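(* There is an equivalence of categories between the category of radical idealic semirings (as a subcategory of the category of semirings) and the category of bounded distributive lattices. Furthermore, this equivalence commutes with the forgetful functors to sets (i.e. it is the identity on the level of sets). In particular, as the category of bounded distributive lattices is antiequivalent to the category of spectral spaces, the category of radical idealic semirings is also antiequivalent to the category of spectral spaces.
   Context: A semiring is a nonempty set $A$ with operations $+,\cdot$ such that $(A,+)$ and $(A,\cdot)$ are commutative monoids (with identities $0$ and $1$), $(a+b)c=ac+bc$ and $0\cdot a=0$ for all $a,b,c\in A$; homomorphisms preserve $+,\cdot,0,1$. A semiring is idempotent if $a+a=a$ for all $a$; it then carries the canonical partial order $x\le y\iff x+y=y$. An idempotent semiring is idealic if $x\le 1$ for all $x$. An idealic semiring is radical if $x^2=x$ for all $x$. Morphisms of radical idealic semirings are semiring homomorphisms. Morphisms of bounded distributive lattices are lattice homomorphisms $f$ (preserving binary meets and joins) with $f(0)=0$ and $f(1)=1$. A spectral space is a quasi-compact $T_0$ topological space in which finite intersections of quasi-compact open subsets are quasi-compact open, the quasi-compact open subsets form a basis, and every nonempty irreducible closed subset has a unique generic point. Morphisms of spectral spaces are spectral maps: continuous maps for which preimages of quasi-compact open sets are quasi-compact. *)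

(* Defs.v *)
From HB Require Import structures.
From mathcomp Require Import all_boot all_order all_algebra.
From mathcomp Require Import boolp classical_sets cardinality filter topology.

Set Implicit Arguments.
Unset Strict Implicit.
Unset Printing Implicit Defensive.

Import Order.TTheory GRing.Theory.
Local Open Scope classical_set_scope.
Local Open Scope ring_scope.

Record category := Category {
  obj :> Type;
  hom : obj -> obj -> Type;
  idm : forall a, hom a a;
  compm : forall a b c, hom b c -> hom a b -> hom a c;
  compm_idl : forall a b (f : hom a b), compm (idm b) f = f;
  compm_idr : forall a b (f : hom a b), compm f (idm a) = f;
  compmA : forall a b c d (h : hom c d) (g : hom b c) (f : hom a b),
    compm h (compm g f) = compm (compm h g) f }.
Arguments hom {_} _ _.
Arguments idm {_} _.
Arguments compm {_ _ _ _} _ _.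

Definition opposite (C : category) : category :=
  @Category C (fun a b => @hom C b a) (@idm C) (fun a b c g f => compm f g)
    (fun a b f => compm_idr f) (fun a b f => compm_idl f)
    (fun a b c d h g f => esym (compmA f g h)).

Definition full_subcategory (C : category) (P : C -> Prop) : category :=
  @Category {a : C | P a} (fun a b => hom (sval a) (sval b))
    (fun a => idm (sval a)) (fun a b c g f => compm g f)
    (fun a b f => compm_idl f) (fun a b f => compm_idr f)
    (fun a b c d h g f => compmA h g f).

Record functor (C D : category) := Functor {
  fobj :> C -> D;
  fmap : forall a b : C, hom a b -> hom (fobj a) (fobj b);
  fmap_id : forall a, fmap (idm a) = idm (fobj a);
  fmap_comp : forall a b c (g : hom b c) (f : hom a b),
    fmap (compm g f) = compm (fmap g) (fmap f) }.
Arguments fmap {_ _} _ {_ _} _.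

Definition id_functor (C : category) : functor C C :=
  @Functor C C id (fun a b f => f) (fun a => erefl) (fun a b c g f => erefl).

Definition comp_functor (C D E : category) (G : functor D E) (F : functor C D) :
  functor C E :=
  @Functor C E (fun a => G (F a)) (fun a b f => fmap G (fmap F f))
    (fun a => etrans (congr1 (fmap G) (fmap_id F a)) (fmap_id G (F a)))
    (fun a b c g f =>
       etrans (congr1 (fmap G) (fmap_comp F g f)) (fmap_comp G _ _)).

Definition inclusion (C : category) (P : C -> Prop) :
  functor (full_subcategory P) C :=
  @Functor (full_subcategory P) C sval (fun a b f => f)
    (fun a => erefl) (fun a b c g f => erefl).

Record natural_iso (C D : category) (F G : functor C D) := NaturalIso {
  iso_hom : forall a, hom (F a) (G a);
  iso_inv : forall a, hom (G a) (F a);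
  iso_natural : forall a b (f : hom a b),
    compm (fmap G f) (iso_hom a) = compm (iso_hom b) (fmap F f);
  iso_homK : forall a, compm (iso_inv a) (iso_hom a) = idm (F a);
  iso_invK : forall a, compm (iso_hom a) (iso_inv a) = idm (G a) }.

Record equivalence (C D : category) := Equivalence {
  eqv_fun : functor C D;
  eqv_inv : functor D C;
  eqv_unit : natural_iso (id_functor C) (comp_functor eqv_inv eqv_fun);
  eqv_counit : natural_iso (comp_functor eqv_fun eqv_inv) (id_functor D) }.

Definition antiequivalent (C D : category) : Prop :=
  inhabited (equivalence (opposite C) D).

Definition Sets : category :=
  @Category Type (fun A B => A -> B) (fun A => id) (fun A B C g f x => g (f x))
    (fun A B f => erefl) (fun A B f => erefl) (fun A B C D h g f => erefl).

Lemma rmorphism_eq (A B : pzSemiRingType) (f g : {rmorphism A -> B}) :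
  f =1 g -> f = g.
Proof.
case: f g => [f [[f1] [f2]]] [g [[g1] [g2]]] /= /funext fg.
by case: _ / fg in g1 g2 *; rewrite (Prop_irrelevance g1 f1) (Prop_irrelevance g2 f2).
Qed.

Definition srmor_id (A : comPzSemiRingType) : {rmorphism A -> A} := idfun.

Definition srmor_comp (A B C : comPzSemiRingType) (g : {rmorphism B -> C})
  (f : {rmorphism A -> B}) : {rmorphism A -> C} := g \o f.

(* [comPzSemiRingType] allows 0 = 1, so the one-element semiring is an object.
   The objects here, as in the other two categories below, carry a choice
   structure: every type admits one classically, and morphisms ignore it, so up
   to isomorphism the objects are unaffected. *)
Definition SemiRing : category.
Proof.
refine (@Category comPzSemiRingType (fun A B => {rmorphism A -> B})
  srmor_id srmor_comp _ _ _); by move=> *; exact: rmorphism_eq.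
Defined.

Definition forget_semiring : functor SemiRing Sets :=
  @Functor SemiRing Sets (fun A : comPzSemiRingType => A : Type)
    (fun A B (f : {rmorphism A -> B}) => f : A -> B)
    (fun A => erefl) (fun A B C g f => erefl).

Definition sr_idempotent (A : comPzSemiRingType) := forall a : A, a + a = a.

Definition sr_le (A : comPzSemiRingType) (x y : A) := x + y = y.

Definition idealic (A : comPzSemiRingType) :=
  sr_idempotent A /\ forall x : A, sr_le x 1.

Definition radical_idealic (A : comPzSemiRingType) :=
  idealic A /\ forall x : A, x ^+ 2 = x.

Definition RadSemiRing : category := @full_subcategory SemiRing radical_idealic.

Definition forget_radsemiring : functor RadSemiRing Sets :=
  comp_functor forget_semiring (@inclusion SemiRing radical_idealic).

(* The library's [{tblmorphism _ -> _}] only asks for preservation of the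
   bounds, not of meets and joins, hence this record on top of
   [{lmorphism _ -> _}]. *)
Record bdlat_hom (d : Order.disp_t) (L M : tbDistrLatticeType d) := BDLatHom {
  bdlat_fun :> {lmorphism L -> M};
  bdlat_bot : bdlat_fun \bot%O = \bot%O;
  bdlat_top : bdlat_fun \top%O = \top%O }.

Lemma bdlat_hom_eq (d : Order.disp_t) (L M : tbDistrLatticeType d)
  (f g : bdlat_hom L M) : f =1 g -> f = g.
Proof.
case: f g => [[f [[fo] [fi] [fu]]] f0 f1] [[g [[go] [gi] [gu]]] g0 g1] /= /funext fg.
case: _ / fg in go gi gu g0 g1 *.
by move: f0 f1 g0 g1; rewrite (Prop_irrelevance go fo) (Prop_irrelevance gi fi)
  (Prop_irrelevance gu fu) => f0 f1 g0 g1; congr BDLatHom; exact: Prop_irrelevance.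
Qed.

HB.instance Definition _ (d : Order.disp_t) (L M N : latticeType d)
  (g : {lmorphism M -> N}) (f : {lmorphism L -> M}) :=
  Order.MeetLatticeMorphism.on (g \o f).

Definition bdlat_id (d : Order.disp_t) (L : tbDistrLatticeType d) :
  bdlat_hom L L := @BDLatHom d L L idfun erefl erefl.

Definition bdlat_comp (d : Order.disp_t) (L M N : tbDistrLatticeType d)
  (g : bdlat_hom M N) (f : bdlat_hom L M) : bdlat_hom L N :=
  @BDLatHom d L N (g \o f)
    (etrans (congr1 g (bdlat_bot f)) (bdlat_bot g))
    (etrans (congr1 g (bdlat_top f)) (bdlat_top g)).

(* The display [d] only tags notations and carries no mathematical content. *)
Definition BDLat (d : Order.disp_t) : category.
Proof.
refine (@Category (tbDistrLatticeType d) (@bdlat_hom d)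
  (@bdlat_id d) (@bdlat_comp d) _ _ _); by move=> *; exact: bdlat_hom_eq.
Defined.

Definition forget_bdlat (d : Order.disp_t) : functor (BDLat d) Sets :=
  @Functor (BDLat d) Sets (fun L : tbDistrLatticeType d => L : Type)
    (fun L M (f : bdlat_hom L M) => f : L -> M)
    (fun L => erefl) (fun L M N g f => erefl).

Definition qc_open (X : topologicalType) (U : set X) := open U /\ compact U.

(* The relatively closed subsets of [Z] are the [Z `&` F] with [F] closed, and
   [Z `&` F = Z] means [Z `<=` F]. The empty set is not excluded here. *)
Definition irreducible (X : topologicalType) (Z : set X) :=
  forall F G : set X, closed F -> closed G ->
    Z `<=` F `|` G -> Z `<=` F \/ Z `<=` G.

Definition generic_point (X : topologicalType) (Z : set X) (x : X) :=
  closure [set x] = Z.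

Record spectral (X : topologicalType) : Prop := Spectral {
  spectral_compact : compact [set: X];
  spectral_T0 : kolmogorov_space X;
  spectral_bigcap : forall A : set (set X), finite_set A ->
    A `<=` @qc_open X -> qc_open (\bigcap_(U in A) U);
  spectral_basis : basis (@qc_open X);
  spectral_generic : forall Z : set X, Z !=set0 -> closed Z -> irreducible Z ->
    exists! x : X, generic_point Z x }.

Record spectral_map (X Y : topologicalType) := SpectralMap {
  spectral_fun :> continuousType X Y;
  spectral_preimage : forall V : set Y, qc_open V ->
    compact (spectral_fun @^-1` V) }.

Lemma spectral_map_eq (X Y : topologicalType) (f g : spectral_map X Y) :
  f =1 g -> f = g.
Proof.
case: f g => [f f1] [g g1] /= /continuousEP fg; case: _ / fg in g1 *.
by congr SpectralMap; exact: Prop_irrelevance.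
Qed.

Definition spectral_id (X : topologicalType) : spectral_map X X :=
  @SpectralMap X X idfun (fun V qcV => proj2 qcV).

Lemma spectral_preimage_comp (X Y Z : topologicalType)
  (g : spectral_map Y Z) (f : spectral_map X Y) (V : set Z) :
  qc_open V -> compact ((g \o f) @^-1` V).
Proof.
move=> qcV; have gV := spectral_preimage qcV (s := g).
apply: (spectral_preimage (V := g @^-1` V)); split=> //.
by apply: open_comp (proj1 qcV) => x _; exact: cts_fun.
Qed.

Definition spectral_comp (X Y Z : topologicalType)
  (g : spectral_map Y Z) (f : spectral_map X Y) : spectral_map X Z :=
  @SpectralMap X Z (g \o f) (@spectral_preimage_comp X Y Z g f).

Definition Spec : category.
Proof.
refine (@Category {X : topologicalType | spectral X}
  (fun X Y => spectral_map (sval X) (sval Y))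
  (fun X => spectral_id (sval X)) (fun X Y Z => @spectral_comp _ _ _) _ _ _);
  by move=> *; exact: spectral_map_eq.
Defined.

(* Main.v *)
(* In a radical idealic semiring [+] is the join of the canonical order and,
   since [x * x = x <= 1], [*] is its meet; so the two kinds of structure on a
   set determine each other and have the same morphisms.

   For Stone duality, a lattice [L] is sent to the space of its prime filters
   with basis [{P | a \in P}], and a spectral space to its lattice of
   quasi-compact opens. An ultrafilter [F] on prime filters converges to the
   prime filter [{a | F {P | a \in P}}], which gives compactness of the basic
   opens; Zorn's lemma separates elements by prime filters; sobriety makes each
   prime filter of quasi-compact opens the filter of neighbourhoods of a point. *)
From HB Require Import structures.
From mathcomp Require Import all_boot all_order all_algebra.
From mathcomp Require Import boolp classical_sets cardinality filter topology.
Require Import Defs.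

Set Implicit Arguments.
Unset Strict Implicit.
Unset Printing Implicit Defensive.

Import Order.TTheory GRing.Theory.
Local Open Scope classical_set_scope.

(** * Inverses, opposites and composites of equivalences *)

Definition natural_iso_sym (C D : category) (F G : functor C D)
  (h : natural_iso F G) : natural_iso G F.
Proof.
refine (@NaturalIso C D G F (iso_inv h) (iso_hom h) _ (iso_invK h) (iso_homK h)).
(* Inserting [iso_inv h b] after [iso_hom h b] on the left exposes the naturality square of [h]. *)
move=> a b f; rewrite -[LHS]compm_idl -(iso_homK h) -compmA; congr compm.
by rewrite compmA -iso_natural -compmA iso_invK compm_idr.
Defined.

(** The two law fields are propositions, so proof irrelevance identifies them. The object map [F] is
    shared, so that the arrow maps can be compared without transport. *)
Lemma functor_eq (C D : category) (F : C -> D)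
  (m m' : forall a b : C, hom a b -> hom (F a) (F b)) p p' q q' :
  m = m' -> @Functor C D F m p q = @Functor C D F m' p' q'.
Proof.
move=> mm'; case: _ / mm' in p' q' *.
by rewrite (Prop_irrelevance p p') (Prop_irrelevance q q').
Qed.

Definition opposite_functor (C D : category) (F : functor C D) :
  functor (opposite C) (opposite D) :=
  @Functor (opposite C) (opposite D) (fobj F)
    (fun a b f => @fmap C D F b a f)
    (fmap_id F) (fun a b c g f => @fmap_comp C D F c b a f g).

(* Reversing arrows turns the components of [id -> GF] into maps [GF a -> a];
   a unit in the right direction is given by the inverse components. *)
Definition opposite_equivalence (C D : category) (e : equivalence C D) :
  equivalence (opposite C) (opposite D).
Proof.
refine (@Equivalence (opposite C) (opposite D)
  (opposite_functor (eqv_fun e)) (opposite_functor (eqv_inv e))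
  (@NaturalIso _ _ (id_functor (opposite C)) (comp_functor
    (opposite_functor (eqv_inv e)) (opposite_functor (eqv_fun e)))
    (iso_inv (eqv_unit e)) (iso_hom (eqv_unit e)) _
    (iso_homK (eqv_unit e)) (iso_invK (eqv_unit e)))
  (@NaturalIso _ _ (comp_functor (opposite_functor (eqv_fun e))
    (opposite_functor (eqv_inv e))) (id_functor (opposite D))
    (iso_inv (eqv_counit e)) (iso_hom (eqv_counit e)) _
    (iso_homK (eqv_counit e)) (iso_invK (eqv_counit e)))) => a b f /=.
- exact: esym (iso_natural (natural_iso_sym (eqv_unit e)) f).
- exact: esym (iso_natural (natural_iso_sym (eqv_counit e)) f).
Defined.

Section EquivalenceComp.
Variables (C D E : category) (e1 : equivalence C D) (e2 : equivalence D E).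
Let F1 := eqv_fun e1.
Let G1 := eqv_inv e1.
Let F2 := eqv_fun e2.
Let G2 := eqv_inv e2.

Definition equivalence_comp_unit : natural_iso (id_functor C)
  (comp_functor (comp_functor G1 G2) (comp_functor F2 F1)).
Proof.
refine (@NaturalIso _ _ (id_functor C)
    (comp_functor (comp_functor G1 G2) (comp_functor F2 F1))
  (fun a => compm (fmap G1 (iso_hom (eqv_unit e2) (F1 a))) (iso_hom (eqv_unit e1) a))
  (fun a => compm (iso_inv (eqv_unit e1) a) (fmap G1 (iso_inv (eqv_unit e2) (F1 a))))
  _ _ _).
- move=> a b f /=; rewrite compmA -(fmap_comp G1).
  rewrite (iso_natural (eqv_unit e2) (fmap F1 f)) /= (fmap_comp G1) -!compmA.
  by congr compm; exact: (iso_natural (eqv_unit e1) f).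
- move=> a; rewrite -compmA (compmA (fmap G1 _)) -(fmap_comp G1).
  by rewrite (iso_homK (eqv_unit e2)) (fmap_id G1) compm_idl (iso_homK (eqv_unit e1)).
- move=> a; rewrite -compmA (compmA (iso_hom (eqv_unit e1) a)).
  rewrite (iso_invK (eqv_unit e1)) compm_idl -(fmap_comp G1).
  by rewrite (iso_invK (eqv_unit e2)) (fmap_id G1).
Defined.

Definition equivalence_comp_counit : natural_iso
  (comp_functor (comp_functor F2 F1) (comp_functor G1 G2)) (id_functor E).
Proof.
refine (@NaturalIso _ _
    (comp_functor (comp_functor F2 F1) (comp_functor G1 G2)) (id_functor E)
  (fun a => compm (iso_hom (eqv_counit e2) a) (fmap F2 (iso_hom (eqv_counit e1) (G2 a))))
  (fun a => compm (fmap F2 (iso_inv (eqv_counit e1) (G2 a))) (iso_inv (eqv_counit e2) a))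
  _ _ _).
- move=> a b f /=; rewrite compmA (iso_natural (eqv_counit e2) f) -!compmA /=.
  by rewrite -!(fmap_comp F2); congr (compm _ (fmap _ _));
    exact: (iso_natural (eqv_counit e1) (fmap G2 f)).
- move=> a; rewrite -compmA (compmA (iso_inv (eqv_counit e2) a)).
  rewrite (iso_homK (eqv_counit e2)) compm_idl -(fmap_comp F2).
  by rewrite (iso_homK (eqv_counit e1)) (fmap_id F2).
- move=> a; rewrite -compmA (compmA (fmap F2 _)) -(fmap_comp F2).
  rewrite (iso_invK (eqv_counit e1)) (fmap_id F2).
  by rewrite compm_idl (iso_invK (eqv_counit e2)).
Defined.

Definition equivalence_comp : equivalence C E :=
  Equivalence equivalence_comp_unit equivalence_comp_counit.

End EquivalenceComp.

(** * Radical idealic semirings and bounded distributive lattices *)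

Section RadicalSemiringLattice.
Variables (d : Order.disp_t) (A : comPzSemiRingType) (hA : radical_idealic A).
Local Open Scope ring_scope.

(* A bare alias of the carrier, so that forgetting to sets is strict. *)
Definition radlat of radical_idealic A := A : Type.
Local Notation T := (radlat hA).

HB.instance Definition _ := Choice.on T.

Let meet (x y : T) : T := (x : A) * y.
Let join (x y : T) : T := (x : A) + y.
(** This agrees with the canonical order [sr_le]: the two are the meet and join descriptions of the
    same lattice order, equivalent by absorption. *)
Let le (x y : T) := meet x y == x.
Let lt (x y : T) := (y != x) && le x y.

Let meetA : associative meet. Proof. exact: mulrA. Qed.
Let meetC : commutative meet. Proof. exact: mulrC. Qed.
Let joinA : associative join. Proof. exact: addrA. Qed.
Let joinC : commutative join. Proof. exact: addrC. Qed.
Let meetxx : idempotent_op meet.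
Proof. by move=> x; have [_ h] := hA; exact: h. Qed.
Let joinx1 (x : A) : x + 1 = 1. Proof. by have [[_ h] _] := hA; exact: h. Qed.
(** Here idealicity enters: [x + x * y = x * (1 + y)] and [1 + y = 1]. *)
Let meetKU (y x : T) : join x (meet x y) = x.
Proof. by rewrite /join /meet -{1}[x : A]mulr1 -mulrDr addrC joinx1 mulr1. Qed.
(** Radicality reduces [x * (x + y) = x * x + x * y] to the other absorption law. *)
Let joinKI (y x : T) : meet x (join x y) = x.
Proof. by rewrite /meet mulrDr [_ * _]meetxx; exact: meetKU. Qed.
Let meetUl : left_distributive meet join.
Proof. by move=> x y z; exact: mulrDl. Qed.

HB.instance Definition _ := @Order.isMeetJoinDistrLattice.Build d T le lt
  meet join (fun _ _ => erefl) (fun _ _ => erefl) meetC joinC meetA joinA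
  joinKI meetKU meetUl meetxx.

Let le0x (x : T) : ((0%R : A) <= x :> T)%O.
Proof. by rewrite leEmeet; apply/eqP; exact: mul0r. Qed.
Let lex1 (x : T) : (x <= (1%R : A) :> T)%O.
Proof. by rewrite leEmeet; apply/eqP; exact: mulr1. Qed.

HB.instance Definition _ := @Order.hasBottom.Build d T (0 : A) le0x.
HB.instance Definition _ := @Order.hasTop.Build d T (1 : A) lex1.

End RadicalSemiringLattice.

Section LatticeSemiring.
Variables (d : Order.disp_t) (L : tbDistrLatticeType d).
Local Open Scope order_scope.

Definition latsr := L : Type.

HB.instance Definition _ := Choice.on latsr.
HB.instance Definition _ := @GRing.isNmodule.Build latsr (\bot : L)
  (Order.join : L -> L -> L) (@joinA _ L) (@joinC _ L) (@join0x _ L).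
HB.instance Definition _ := @GRing.Nmodule_isComPzSemiRing.Build latsr
  (\top : L) (Order.meet : L -> L -> L) (@meetA _ L) (@meetC _ L) (@meet1x _ L)
  (@meetUl _ L) (@meet0x _ L).

Lemma latsr_radical_idealic : radical_idealic latsr.
Proof.
split; last by move=> x; exact: meetxx.
by split=> x; [exact: joinxx|exact: joinx1].
Qed.

End LatticeSemiring.

Definition rmorphism_of (A B : comPzSemiRingType) (f : A -> B)
  (fD : nmod_morphism f) (fM : monoid_morphism f) : {rmorphism A -> B} :=
  HB.pack f (GRing.isNmodMorphism.Build A B f fD)
    (GRing.isMonoidMorphism.Build A B f fM).

Section BDLatHomOf.
Variables (d : Order.disp_t) (L M : tbDistrLatticeType d) (f : L -> M).
Hypotheses (fI : {morph f : x y / (x `&` y)%O})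
  (fU : {morph f : x y / (x `|` y)%O})
  (f0 : f \bot%O = \bot%O) (f1 : f \top%O = \top%O).

Lemma meet_morph_le : {homo f : x y / (x <= y)%O}.
Proof. by move=> x y; rewrite !leEmeet -fI => /eqP ->. Qed.

Definition lmorphism_of : {lmorphism L -> M} :=
  HB.pack f (Order.isOrderMorphism.Build d L d M f meet_morph_le)
    (Order.isMeetLatticeMorphism.Build d L d M f fI)
    (Order.isJoinLatticeMorphism.Build d L d M f fU).

Definition bdlat_hom_of : bdlat_hom L M := @BDLatHom d L M lmorphism_of f0 f1.

End BDLatHomOf.

(** Since [f] is injective, each preservation law for [g] may be checked after applying [f], where
    [g] cancels. *)
Definition bdlat_hom_can (d : Order.disp_t) (L M : tbDistrLatticeType d)
  (f : bdlat_hom L M) (g : M -> L) (fK : cancel f g) (gK : cancel g f) :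
  bdlat_hom M L.
Proof.
apply: (@bdlat_hom_of d M L g) => [x y|x y||]; apply: (can_inj fK).
- by rewrite (omorphI f) /= !gK.
- by rewrite (omorphU f) /= !gK.
- by rewrite (bdlat_bot f) gK.
- by rewrite (bdlat_top f) gK.
Defined.

Definition radlat_hom (d : Order.disp_t) (A B : comPzSemiRingType)
  (hA : radical_idealic A) (hB : radical_idealic B) (f : {rmorphism A -> B}) :
  bdlat_hom (radlat hA : tbDistrLatticeType d) (radlat hB) :=
  @bdlat_hom_of d (radlat hA) (radlat hB) f
    (rmorphM f) (rmorphD f) (rmorph0 f) (rmorph1 f).

Definition latsr_hom (d : Order.disp_t) (L M : tbDistrLatticeType d)
  (f : bdlat_hom L M) : {rmorphism latsr L -> latsr M} :=
  @rmorphism_of (latsr L) (latsr M) f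
    (conj (bdlat_bot f) (omorphU f)) (conj (bdlat_top f) (omorphI f)).

Section RadicalSemiringEquivalence.
Variable d : Order.disp_t.

Definition lattice_of_semiring : functor RadSemiRing (BDLat d).
Proof.
refine (@Functor RadSemiRing (BDLat d)
  (fun A => radlat (proj2_sig A) : tbDistrLatticeType d)
  (fun A B f => radlat_hom d (proj2_sig A) (proj2_sig B) f) _ _);
  by move=> *; exact: bdlat_hom_eq.
Defined.

Definition semiring_of_lattice : functor (BDLat d) RadSemiRing.
Proof.
refine (@Functor (BDLat d) RadSemiRing
  (fun L : tbDistrLatticeType d =>
    exist radical_idealic (latsr L : comPzSemiRingType) (latsr_radical_idealic L))
  (fun L M f => latsr_hom f) _ _); by move=> *; exact: rmorphism_eq.
Defined.

(** The round trip keeps the carrier and, up to conversion, the operations; only the packaging of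
    the structure changes, so the identity function is a homomorphism both ways. *)
Definition radlatK_iso : natural_iso (id_functor RadSemiRing)
  (comp_functor semiring_of_lattice lattice_of_semiring).
Proof.
pose LA (A : RadSemiRing) := latsr (radlat (proj2_sig A) : tbDistrLatticeType d).
have idD (A : RadSemiRing) : nmod_morphism (idfun : sval A -> LA A) by [].
have idM (A : RadSemiRing) : monoid_morphism (idfun : sval A -> LA A) by [].
have idD' (A : RadSemiRing) : nmod_morphism (idfun : LA A -> sval A) by [].
have idM' (A : RadSemiRing) : monoid_morphism (idfun : LA A -> sval A) by [].
refine (@NaturalIso RadSemiRing RadSemiRing (id_functor RadSemiRing)
  (comp_functor semiring_of_lattice lattice_of_semiring)
  (fun A => rmorphism_of (idD A) (idM A)) (fun A => rmorphism_of (idD' A) (idM' A))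
  _ _ _); by move=> *; exact: rmorphism_eq.
Defined.

Definition latsrK_iso : natural_iso
  (comp_functor lattice_of_semiring semiring_of_lattice) (id_functor (BDLat d)).
Proof.
pose LL (L : tbDistrLatticeType d) : tbDistrLatticeType d :=
  radlat (latsr_radical_idealic L).
refine (@NaturalIso (BDLat d) (BDLat d)
  (comp_functor lattice_of_semiring semiring_of_lattice) (id_functor (BDLat d))
  (fun L : tbDistrLatticeType d => @bdlat_hom_of d (LL L) L idfun
    (fun _ _ => erefl) (fun _ _ => erefl) erefl erefl)
  (fun L : tbDistrLatticeType d => @bdlat_hom_of d L (LL L) idfun
    (fun _ _ => erefl) (fun _ _ => erefl) erefl erefl)
  _ _ _); by move=> *; exact: bdlat_hom_eq.
Defined.

Definition radsemiring_equivalence : equivalence RadSemiRing (BDLat d) :=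
  Equivalence radlatK_iso latsrK_iso.

(** [radlat] unfolds to the carrier, so object and arrow maps agree by conversion and only the
    proofs of the functor laws need identifying. *)
Lemma forget_lattice_of_semiring :
  comp_functor (forget_bdlat d) lattice_of_semiring = forget_radsemiring.
Proof. exact: functor_eq. Qed.

Lemma forget_semiring_of_lattice :
  comp_functor forget_radsemiring semiring_of_lattice = forget_bdlat d.
Proof. exact: functor_eq. Qed.

End RadicalSemiringEquivalence.

(** * Prime filters and their existence *)

Section PrimeFilters.
Variables (d : Order.disp_t) (L : tbDistrLatticeType d).
Implicit Types (a b c x y : L).
Local Open Scope order_scope.

(** The equivalence for meets packs closure under meets with upward closure, and the one for joins
    contains primeness. Together the fields say that the indicator function of [P] is a bounded
    lattice homomorphism to the two-element lattice. *)
Record prime_filter (P : set L) : Prop := PrimeFilter {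
  prime_filterT : P \top;
  prime_filter0 : ~ P \bot;
  prime_filterI : forall a b, P (a `&` b) <-> P a /\ P b;
  prime_filterU : forall a b, P (a `|` b) <-> P a \/ P b }.

Lemma prime_filter_le (P : set L) a b : prime_filter P -> a <= b -> P a -> P b.
Proof. by move=> Pp /meet_idPl {1}<- /(prime_filterI Pp) []. Qed.

(** A filter maximal among those containing [a] but not [b] is prime: if it contained neither [x]
    nor [y], maximality would give members [z], [t] whose meets with [x], [y] lie below [b], and by
    distributivity the meet of [z], [t] and the join of [x], [y] would lie below [b] too. *)
Lemma prime_filter_exists a b : ~~ (a <= b) ->
  exists P : set L, [/\ prime_filter P, P a & ~ P b].
Proof.
move=> Nab.
pose separating (F : set L) := [/\ F a, ~ F b,
  forall x y, x <= y -> F x -> F y & forall x y, F x -> F y -> F (x `&` y)].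
(* The empty set is admitted as the union of the empty chain. *)
have [F|F [sepF maxF]] := @Zorn_bigcup L (fun F => F = set0 \/ separating F).
  move=> FP Ftot; have [[G FG [x Gx]]|F0] := pselect (exists2 G, F G & G !=set0).
    have sepF H y : F H -> H y -> separating H.
      by move=> /FP [->|//].
    right; split.
    - by exists G => //; have [] := sepF _ _ FG Gx.
    - by move=> [H FH Hb]; have [] := sepF _ _ FH Hb.
    - move=> y z yz [H FH Hy]; exists H => //.
      by have [_ _ up _] := sepF _ _ FH Hy; exact: up Hy.
    - move=> y z [H FH Hy] [K FK Kz].
      have [_ _ _ HI] := sepF _ _ FH Hy; have [_ _ _ KI] := sepF _ _ FK Kz.
      by have [HK|KH] := Ftot _ _ FH FK;
        [exists K => //; apply: KI => //; exact: HK
        |exists H => //; apply: HI => //; exact: KH].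
  left; rewrite -subset0 => x [G FG Gx]; apply: F0.
  by exists G => //; exists x.
(* The maximal set is not empty, since the principal filter of [a] would be larger. *)
have {}sepF : separating F.
  case: sepF => // F0; exfalso; apply: (maxF [set x | a <= x]); last first.
    right; split => //=; first exact/negP.
    - by move=> x y xy /le_trans; exact.
    - by move=> x y ax ay; rewrite lexI ax ay.
  by rewrite F0; split=> // /(_ a); apply=> /=.
have [Fa Fb Fle FI] := sepF.
have FT : F \top by apply: Fle Fa; exact: lex1.
(* By maximality, the filter generated by [F] and [c] contains [b]. *)
have FC c : ~ F c -> exists2 x, F x & x `&` c <= b.
  move=> Fc; apply: contrapT => Fcb.
  apply: (maxF [set y | exists2 x, F x & x `&` c <= y]).
    split=> [x Fx|/(_ c)]; first by exists x => //; exact: leIl.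
    by apply: contra_not Fc; apply; exists \top => //; exact: leIr.
  right; split => //=.
  - by exists a => //; exact: leIl.
  - by move=> x y xy [z Fz zx]; exists z => //; exact: le_trans xy.
  - move=> x y [z Fz zx] [t Ft ty]; exists (z `&` t); first exact: FI.
    rewrite lexI (le_trans _ zx) ?(le_trans _ ty) //.
      by rewrite leI2 ?leIr.
    by rewrite leI2 ?leIl.
exists F; split=> //; split=> //.
- by move=> F0; apply: Fb; apply: Fle F0; exact: le0x.
- move=> x y; split=> [Fxy|[Fx Fy]]; last exact: FI.
  by split; apply: Fle Fxy; [exact: leIl|exact: leIr].
- move=> x y; split=> [Fxy|[]]; last 2 first.
  - by apply: Fle; exact: leUl.
  - by apply: Fle; exact: leUr.
  apply: contrapT => /not_orP [/FC [z Fz zx] /FC [t Ft ty]].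
  apply: Fb; apply: Fle (FI _ _ (FI _ _ Fz Ft) Fxy).
  rewrite meetUr leUx (le_trans _ zx) ?(le_trans _ ty) //.
    by rewrite leI2 ?leIr.
  by rewrite leI2 ?leIl.
Qed.

End PrimeFilters.

(** * Compactness, specialisation and T0 in general spaces *)

Section DirectedCover.
Variable X : topologicalType.
Implicit Types (K U V : set X) (Q : set (set X)).

(** If no member of [Q] contained [K], directedness would make the sets [K] minus [U] a base of a
    proper filter. A cluster point in [K] lies in some [U] of [Q], which is a neighbourhood disjoint
    from [K] minus [U]. *)
Lemma compact_directed_cover K Q : compact K -> Q `<=` open -> Q !=set0 ->
  (forall U V, Q U -> Q V -> exists2 W, Q W & U `|` V `<=` W) ->
  K `<=` \bigcup_(U in Q) U -> exists2 U, Q U & K `<=` U.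
Proof.
move=> cK oQ [U0 QU0] dirQ covK; apply: contrapT => noU.
pose F := filter_from Q (fun U => K `\` U).
have FF : ProperFilter F.
  apply: filter_from_proper; last first.
    move=> U QU; apply/set0P/negP => /eqP KU; apply: noU.
    by exists U => //; rewrite -setD_eq0.
  apply: filter_from_filter; first by exists U0.
  move=> U V QU QV; have [W QW UVW] := dirQ U V QU QV; exists W => // x [Kx Wx].
  by split; split=> // ?; apply: Wx; apply: UVW; [left|right].
have [|x [Kx clx]] := cK F FF; first by exists U0 => // x [].
have [U QU Ux] := covK x Kx.
have [|y [[_ Uy] /Uy]] // := clx (K `\` U) U _ (open_nbhs_nbhs (conj (oQ U QU) Ux)).
by exists U.
Qed.

Lemma qc_openU U V : qc_open U -> qc_open V -> qc_open (U `|` V).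
Proof. by move=> [oU cU] [oV cV]; split; [exact: openU|exact: compactU]. Qed.

Lemma qc_open0 : qc_open (set0 : set X).
Proof. by split; [exact: open0|exact: compact0]. Qed.

Lemma closure1P x y : closure [set x] y <-> forall U, open U -> U y -> U x.
Proof.
split=> [cly U oU Uy|xy B].
  by have [_ [->]] := cly U (open_nbhs_nbhs (conj oU Uy)).
by rewrite nbhsE => -[U [oU Uy] UB]; exists x; split=> //; apply: UB; exact: xy.
Qed.

(** Points with the same closure have the same open neighbourhoods, which T0 excludes for distinct
    points. This yields uniqueness of generic points. *)
Lemma closure1_inj : kolmogorov_space X -> injective (fun x : X => closure [set x]).
Proof.
move=> T0; suff sym (x y : X) (A : set X) : closure [set x] = closure [set y] ->
    A \in nbhs x -> y \in ~` A -> False.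
  move=> x y xy; apply: contrapT => /eqP /T0 [A [] []]; exact: sym.
rewrite !inE nbhsE => xy [U [oU Ux] UA]; apply; apply: UA.
have /closure1P : closure [set y] x by rewrite -xy; exact: subset_closure.
exact.
Qed.

Lemma qc_open_bigcap (A : set (set X)) : qc_open (setT : set X) ->
  setI_closed (@qc_open X) -> finite_set A -> A `<=` @qc_open X ->
  qc_open (\bigcap_(U in A) U).
Proof.
move=> qcT qcI /finite_seqP [s ->] sqc; rewrite bigcap_seq big_seq.
by apply: big_rec => // U V Us qcV; apply: qcI => //; exact: sqc.
Qed.

End DirectedCover.

(** * The prime spectrum of a lattice is a spectral space *)

Section PrimeSpectrum.
Variables (d : Order.disp_t) (L : tbDistrLatticeType d).
Implicit Types (a b c : L).
Local Open Scope order_scope.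

Definition pspec := {P : set L | prime_filter P}.
Implicit Types (P Q : pspec) (U Z : set pspec).

Definition basic_open a : set pspec := [set P | sval P a].

Lemma pspec_ext P Q : (forall a, sval P a <-> sval Q a) -> P = Q.
Proof.
case: P Q => [P pP] [Q pQ] /= PQ.
by apply: eq_exist; apply/funext => a; exact/propext.
Qed.

Lemma basic_openI a b : basic_open (a `&` b) = (basic_open a `&` basic_open b)%classic.
Proof. by apply/seteqP; split=> P /(prime_filterI (svalP P)). Qed.

Lemma basic_openU a b : basic_open (a `|` b) = (basic_open a `|` basic_open b)%classic.
Proof. by apply/seteqP; split=> P /(prime_filterU (svalP P)). Qed.

Lemma basic_openT : basic_open \top = setT.
Proof. by apply/seteqP; split=> P // _; exact: prime_filterT (svalP P). Qed.

Lemma basic_open0 : basic_open \bot = set0.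
Proof. by rewrite -subset0 => P /(prime_filter0 (svalP P)). Qed.

(** The converse direction is separation by prime filters; it makes [basic_open] an order
    embedding. *)
Lemma le_basic_open a b : (a <= b) = `[< basic_open a `<=` basic_open b >].
Proof.
apply/idP/asboolP => [ab P|Dab]; first exact: prime_filter_le (svalP P) ab.
apply: contrapT => /negP/prime_filter_exists [P [pP Pa Pb]].
exact: Pb (Dab (exist _ P pP) Pa).
Qed.

Lemma basic_open_inj : injective basic_open.
Proof. by move=> a b ab; apply: le_anti; rewrite !le_basic_open ab asboolT. Qed.

(** A pointwise form of being a union of basic opens. *)
Definition pspec_open U := forall P, U P ->
  exists2 a, sval P a & basic_open a `<=` U.

Let pspec_openT : pspec_open setT.
Proof. by move=> P _; exists \top => //; exact: prime_filterT (svalP P). Qed.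

Let pspec_openI : setI_closed pspec_open.
Proof.
move=> U V oU oV P [/oU [a Pa aU] /oV [b Pb bV]]; exists (a `&` b).
  exact/(prime_filterI (svalP P)).
by rewrite basic_openI => Q [/aU ? /bV ?].
Qed.

Let pspec_open_bigU (I : Type) (f : I -> set pspec) :
  (forall i, pspec_open (f i)) -> pspec_open (\bigcup_i f i).
Proof.
move=> fo P [i _ /fo [a Pa aU]]; exists a => // Q /aU ?; by exists i.
Qed.

HB.instance Definition _ := gen_eqMixin pspec.
HB.instance Definition _ := gen_choiceMixin pspec.
HB.instance Definition _ :=
  isOpenTopological.Build pspec pspec_openT pspec_openI pspec_open_bigU.

Lemma open_basic_open a : open (basic_open a).
Proof. by move=> P Pa; exists a. Qed.

Lemma pspec_openP U : open U <-> pspec_open U.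
Proof. by []. Qed.

Lemma compact_basic_open a : compact (basic_open a).
Proof.
rewrite compact_ultra => F FU Fa.
have FF := @ultra_proper _ _ FU.
have pP : prime_filter [set b | F (basic_open b)].
  split=> /=.
  - by rewrite basic_openT; exact: filterT.
  - by rewrite basic_open0; exact: filter_not_empty.
  - move=> b c; rewrite basic_openI; split=> [Fbc|[]]; last exact: filterI.
    by split; apply: filterS Fbc; [exact: subIsetl|exact: subIsetr].
  - move=> b c; rewrite basic_openU; split=> [Fbc|[]]; last 2 first.
    + by apply: filterS; exact: subsetUl.
    + by apply: filterS; exact: subsetUr.
    (* The ultrafilter contains [basic_open b] or its complement; in the latter case, intersecting
       with the union leaves a subset of [basic_open c]. *)
    have [|Fb] := in_ultra_setVsetC (basic_open b) FU; first by left.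
    by right; apply: filterS (filterI Fbc Fb) => P [[]].
(* By construction every basic neighbourhood of this prime filter belongs to [F], which is
   convergence. *)
exists (exist _ _ pP); split=> // B; rewrite nbhsE => -[U [/pspec_openP oU UP] UB].
by have [b Fb bU] := oU _ UP; apply: filterS Fb => Q /bU /UB.
Qed.

Lemma qc_basic_open a : qc_open (basic_open a).
Proof. by split; [exact: open_basic_open|exact: compact_basic_open]. Qed.

(** The basic opens inside [U] cover it and are directed by joins, so compactness puts [U] inside a
    single one. *)
Lemma qc_open_basic U : qc_open U -> exists a, U = basic_open a.
Proof.
move=> [oU cU]; pose B := [set V | exists2 a, V = basic_open a & V `<=` U].
have [||||V [a ->] aU Ua] := @compact_directed_cover pspec U B cU.
- by move=> _ [a -> _]; exact: open_basic_open.
- by exists set0, \bot => //; rewrite basic_open0.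
- move=> _ _ [a -> aU] [b -> bU]; exists (basic_open (a `|` b)); rewrite basic_openU //.
  by exists (a `|` b); rewrite ?basic_openU // subUset.
- move=> P UP; have [a Pa aU] := oU P UP.
  by exists (basic_open a) => //; exists a.
by exists a; apply/seteqP.
Qed.

(** It suffices to test specialisation on basic opens. Passing to complements, which are prime
    ideals, reverses the inclusion. *)
Lemma pspec_closure P Q : closure [set P] Q <-> sval Q `<=` sval P.
Proof.
rewrite closure1P; split=> [QP a|QP U /pspec_openP oU /oU [a Qa]].
  exact: (QP _ (@open_basic_open a)).
by apply; exact: QP.
Qed.

Lemma pspec_kolmogorov : kolmogorov_space pspec.
Proof.
suff sep (P Q : pspec) a : sval P a -> ~ sval Q a ->
    basic_open a \in nbhs P /\ Q \in ~` basic_open a.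
  move=> P Q PQ; have [a] : exists a, ~ (sval P a <-> sval Q a).
    by apply/existsNP; apply: contra_not (elimN eqP PQ); exact: pspec_ext.
  have [Pa nPQ|Pa nPQ] := pselect (sval P a); exists (basic_open a).
    by left; apply: sep => // Qa; exact: nPQ.
  right; apply: sep => //; apply: contrapT => Qa; apply: nPQ.
  by split=> // /Pa.
move=> Pa Qa; rewrite !inE; split=> //.
exact/open_nbhs_nbhs/(conj (@open_basic_open a)).
Qed.

(** The generic point is the filter of all [a] whose basic open meets [Z]. Its closure under meets
    is irreducibility applied to the complements of two basic opens. *)
Lemma pspec_generic Z : Z !=set0 -> closed Z -> irreducible Z ->
  exists P, generic_point Z P.
Proof.
move=> [P0 ZP0] clZ irZ; pose F : set L := [set a | Z `&` basic_open a !=set0]%classic.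
have Fle a b : a <= b -> F a -> F b.
  rewrite le_basic_open => /asboolP ab [P [ZP /ab Pb]].
  by exists P.
have pF : prime_filter F.
  split.
  - by exists P0; rewrite basic_openT.
  - by rewrite /F /= basic_open0 setI0 => -[].
  - move=> a b; split=> [Fab|[Fa Fb]].
      by split; apply: Fle Fab; [exact: leIl|exact: leIr].
    apply: contrapT => Fab.
    have clC c : closed (~` basic_open c).
      exact: open_closedC (@open_basic_open c).
    have [P ZP|Za|Zb] := irZ _ _ (clC a) (clC b).
    + rewrite -setCI -basic_openI => Pab; apply: Fab.
      by exists P.
    + by have [P [/Za]] := Fa.
    + by have [P [/Zb]] := Fb.
  - move=> a b; rewrite /F /= basic_openU setIUr.
    split=> [[P [HP|HP]]|[[P HP]|[P HP]]]; [left|right| |]; exists P => //.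
      by left.
    by right.
exists (exist _ F pF); apply/seteqP; split=> P; rewrite pspec_closure /=.
  move=> PF; apply: contrapT => nZP.
  (* A point [P] outside [Z] has a basic neighbourhood disjoint from [Z], but its index lies in [F],
     so it meets [Z]. *)
  have /pspec_openP/(_ P nZP) [a /PF [Q [ZQ Qa]] aZ] := closed_openC clZ.
  exact: aZ Qa ZQ.
by move=> ZP a Pa; exists P.
Qed.

Lemma pspec_spectral : spectral pspec.
Proof.
split.
- by rewrite -basic_openT; exact: compact_basic_open.
- exact: pspec_kolmogorov.
- move=> A; apply: qc_open_bigcap; first by rewrite -basic_openT; exact: qc_basic_open.
  move=> _ _ /qc_open_basic [a ->] /qc_open_basic [b ->].
  by rewrite -basic_openI; exact: qc_basic_open.
- split=> [U []//|P B]; rewrite nbhsE => -[U [/pspec_openP oU UP] UB].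
  have [a Pa aU] := oU P UP; exists (basic_open a); last exact: subset_trans UB.
  by split=> //; exact: qc_basic_open.
- move=> Z Z0 clZ irZ; have [P ZP] := pspec_generic Z0 clZ irZ.
  exists P; split=> // Q ZQ; apply: (closure1_inj pspec_kolmogorov).
  by rewrite /= ZP ZQ.
Qed.

End PrimeSpectrum.

Definition spectral_map_of (X Y : topologicalType) (f : X -> Y)
  (fc : continuous f) (fqc : forall V, qc_open V -> compact (f @^-1` V)) :
  spectral_map X Y :=
  @SpectralMap X Y (HB.pack f (isContinuous.Build X Y f fc)) fqc.

Section PrimeSpectrumMap.
Variables (d : Order.disp_t) (L M : tbDistrLatticeType d) (f : bdlat_hom L M).

Lemma prime_filter_preimage (P : pspec M) : prime_filter (f @^-1` sval P).
Proof.
have pP := svalP P; split=> /=.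
- by rewrite bdlat_top; exact: prime_filterT pP.
- by rewrite bdlat_bot; exact: prime_filter0 pP.
- by move=> a b; rewrite omorphI; exact: prime_filterI pP _ _.
- by move=> a b; rewrite omorphU; exact: prime_filterU pP _ _.
Qed.

Definition pspec_fun (P : pspec M) : pspec L := exist _ _ (prime_filter_preimage P).

Lemma pspec_fun_continuous : continuous pspec_fun.
Proof.
apply/continuousP => U /pspec_openP oU; apply/pspec_openP => P /oU [a Pa aU].
by exists (f a) => // Q Qa; exact: aU.
Qed.

(** The preimage of [basic_open a] is [basic_open (f a)] by conversion. *)
Lemma pspec_fun_compact (V : set (pspec L)) : qc_open V -> compact (pspec_fun @^-1` V).
Proof. by move=> /qc_open_basic [a ->]; exact: (@compact_basic_open _ _ (f a)). Qed.

Definition pspec_map : spectral_map (pspec M) (pspec L) :=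
  spectral_map_of pspec_fun_continuous pspec_fun_compact.

End PrimeSpectrumMap.

(** * The lattice of quasi-compact opens of a spectral space *)

Section QuasiCompactOpens.
Variables (d : Order.disp_t) (X : topologicalType) (sX : spectral X).

(** The proof of spectrality is an argument of the type so that the lattice instance, whose meet
    depends on it, can be attached. *)
Definition qcopens of spectral X := {U : set X | qc_open U}.
Local Notation T := (qcopens sX).

Lemma spectral_qc_openT : qc_open (setT : set X).
Proof. by split; [exact: openT|exact: spectral_compact sX]. Qed.

Lemma spectral_qc_openI (U V : set X) : qc_open U -> qc_open V -> qc_open (U `&` V).
Proof.
move=> qU qV; have := @spectral_bigcap _ sX [set U; V] (finite_set2 U V).
rewrite bigcap_setU1 bigcap_set1; apply=> W.
by move=> -[->|->].
Qed.

HB.instance Definition _ := gen_eqMixin T.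
HB.instance Definition _ := gen_choiceMixin T.

Let meet (U V : T) : T := exist _ _ (spectral_qc_openI (svalP U) (svalP V)).
Let join (U V : T) : T := exist _ _ (qc_openU (svalP U) (svalP V)).
Let le (U V : T) := meet U V == U.
Let lt (U V : T) := (V != U) && le U V.

Lemma qcopens_ext (U V : T) : sval U = sval V -> U = V.
Proof. by case: U V => [U qU] [V qV]; exact: eq_exist. Qed.

Let meetA : associative meet.
Proof. by move=> U V W; apply: qcopens_ext; exact: setIA. Qed.
Let meetC : commutative meet.
Proof. by move=> U V; apply: qcopens_ext; exact: setIC. Qed.
Let joinA : associative join.
Proof. by move=> U V W; apply: qcopens_ext; exact: setUA. Qed.
Let joinC : commutative join.
Proof. by move=> U V; apply: qcopens_ext; exact: setUC. Qed.
Let meetxx : idempotent_op meet.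
Proof. by move=> U; apply: qcopens_ext; exact: setIid. Qed.
Let joinKI (V U : T) : meet U (join U V) = U.
Proof. by apply: qcopens_ext; rewrite /= setUC; exact: setKU. Qed.
Let meetKU (V U : T) : join U (meet U V) = U.
Proof. by apply: qcopens_ext; rewrite /= setIC; exact: setKI. Qed.
Let meetUl : left_distributive meet join.
Proof. by move=> U V W; apply: qcopens_ext; exact: setIUl. Qed.

HB.instance Definition _ := @Order.isMeetJoinDistrLattice.Build d T le lt
  meet join (fun _ _ => erefl) (fun _ _ => erefl) meetC joinC meetA joinA
  joinKI meetKU meetUl meetxx.

Let bot : T := exist _ _ (@qc_open0 X).
Let top : T := exist _ _ spectral_qc_openT.

Let le0x (U : T) : (bot <= U)%O.
Proof. by rewrite leEmeet; apply/eqP/qcopens_ext; exact: set0I. Qed.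
Let lex1 (U : T) : (U <= top)%O.
Proof. by rewrite leEmeet; apply/eqP/qcopens_ext; exact: setIT. Qed.

HB.instance Definition _ := @Order.hasBottom.Build d T bot le0x.
HB.instance Definition _ := @Order.hasTop.Build d T top lex1.

(** The carrier does not mention [d], so the bundled lattice is named with its display fixed. *)
Definition qclat : tbDistrLatticeType d := Order.TBDistrLattice.clone d T _.

Lemma le_qclat (U V : qclat) : (U <= V)%O = `[< sval U `<=` sval V >].
Proof.
rewrite leEmeet; apply/eqP/asboolP => [<-|UV]; first exact: subIsetr.
by apply: qcopens_ext; exact/setIidPl.
Qed.

End QuasiCompactOpens.

Section QuasiCompactOpensMap.
Variables (d : Order.disp_t) (X Y : topologicalType) (sX : spectral X) (sY : spectral Y).
Variable f : spectral_map X Y.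

Lemma spectral_map_preimage (V : set Y) : qc_open V -> qc_open (f @^-1` V).
Proof.
move=> qV; split; last exact: spectral_preimage.
by apply: open_comp (proj1 qV) => x _; exact: cts_fun.
Qed.

Definition qclat_fun (V : qclat d sY) : qclat d sX :=
  exist _ _ (spectral_map_preimage (svalP V)).

Definition qclat_map : bdlat_hom (qclat d sY) (qclat d sX).
Proof. apply: (@bdlat_hom_of _ _ _ qclat_fun) => [U V|U V||]; exact: qcopens_ext. Defined.

End QuasiCompactOpensMap.

(** * The Stone functors and their natural isomorphisms *)

Section StoneFunctors.
Variable d : Order.disp_t.

Definition pspec_functor : functor (opposite (BDLat d)) Spec.
Proof.
refine (@Functor (opposite (BDLat d)) Spec
  (fun L : tbDistrLatticeType d =>
    exist spectral (pspec L : topologicalType) (pspec_spectral L))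
  (fun (L M : tbDistrLatticeType d) (f : bdlat_hom M L) => pspec_map f) _ _).
- by move=> L; apply: spectral_map_eq => P; exact: pspec_ext.
- by move=> L M N g f; apply: spectral_map_eq => P; exact: pspec_ext.
Defined.

Definition qclat_functor : functor Spec (opposite (BDLat d)).
Proof.
refine (@Functor Spec (opposite (BDLat d))
  (fun X => qclat d (proj2_sig X))
  (fun X Y f => qclat_map d (proj2_sig X) (proj2_sig Y) f) _ _).
- by move=> X; apply: bdlat_hom_eq => P; exact: qcopens_ext.
- by move=> X Y Z g f; apply: bdlat_hom_eq => P; exact: qcopens_ext.
Defined.

End StoneFunctors.

Section BasicOpenIso.
Variables (d : Order.disp_t) (L : tbDistrLatticeType d).
Local Notation KS := (qclat d (pspec_spectral L)).

Definition basic_open_hom : bdlat_hom L KS.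
Proof.
apply: (@bdlat_hom_of _ L KS (fun a => exist _ _ (qc_basic_open a))).
- by move=> a b; apply: qcopens_ext; exact: basic_openI.
- by move=> a b; apply: qcopens_ext; exact: basic_openU.
- by apply: qcopens_ext; exact: basic_open0.
- by apply: qcopens_ext; exact: basic_openT.
Defined.

Definition basic_open_inv (U : KS) : L := projT1 (cid (qc_open_basic (svalP U))).

Lemma basic_open_invK : cancel basic_open_inv basic_open_hom.
Proof.
move=> U; apply: qcopens_ext => /=; rewrite /basic_open_inv.
by case: cid => a /= ->.
Qed.

(** A right inverse of an injective map is also a left inverse. *)
Lemma basic_open_homK : cancel basic_open_hom basic_open_inv.
Proof.
by move=> a; apply: basic_open_inj; exact: (congr1 sval (basic_open_invK _)).
Qed.

Definition basic_open_inv_hom : bdlat_hom KS L :=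
  bdlat_hom_can basic_open_homK basic_open_invK.

End BasicOpenIso.

Section PointIso.
Variables (d : Order.disp_t) (X : topologicalType) (sX : spectral X).
Local Notation K := (qclat d sX).
Implicit Types (x : X) (U V : K) (P : pspec K).

Lemma prime_filter_point x : prime_filter [set U : K | sval U x].
Proof. by split. Qed.

Definition point_fun x : pspec K := exist _ _ (prime_filter_point x).

Lemma spectral_qc_nbhs x (A : set X) : nbhs x A ->
  exists2 U : K, sval U x & sval U `<=` A.
Proof.
have [_ /(_ x) xB] := spectral_basis sX.
by move=> /xB [U [qU Ux] UA]; exists (exist _ U qU).
Qed.

(** Quasi-compact opens form a basis, so points lying in the same ones have equal closures, and T0
    applies. *)
Lemma point_fun_inj : injective point_fun.
Proof.
move=> x y xy; apply: (closure1_inj (spectral_T0 sX)); move: xy.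
suff le_closure (u v : X) : point_fun u = point_fun v ->
    closure [set u] `<=` closure [set v].
  by move=> xy; apply/seteqP; split; exact: le_closure.
move=> uv t; rewrite !closure1P => clt A oA At.
have [U Ut UA] := spectral_qc_nbhs (open_nbhs_nbhs (conj oA At)).
apply: UA; rewrite -[sval U v]/(sval (point_fun v) U) -uv.
by apply: clt => //; exact: proj1 (svalP U).
Qed.

(* Sobriety: the points whose basic neighbourhoods all lie in the prime filter
   form an irreducible closed set, whose generic point recovers the filter. *)
Lemma point_fun_surj P : exists x, point_fun x = P.
Proof.
have pP := svalP P.
pose Z : set X := ~` \bigcup_(V in [set V : K | ~ sval P V]) sval V.
(* If [U] in [P] missed [Z], it would be covered by quasi-compact opens outside [P]. These are
   directed because [P] is prime, so one of them would contain [U], against upward closure. *)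
have ZP U : sval P U <-> Z `&` sval U !=set0.
  split=> [PU|[x [Zx Ux]]]; last first.
    by apply: contrapT => NPU; apply: Zx; exists U.
  apply: contrapT => ZU.
  pose Q := [set sval V | V in [set V : K | ~ sval P V]].
  have [||||_ [V NPV <-] UV] := @compact_directed_cover X (sval U) Q (proj2 (svalP U)).
  - by move=> _ [V _ <-]; exact: proj1 (svalP V).
  - by exists (sval (\bot%O : K)), (\bot%O : K) => //; exact: prime_filter0 pP.
  - move=> _ _ [V NPV <-] [W NPW <-]; exists (sval (V `|` W)%O) => //.
    by exists (V `|` W)%O => //= /(prime_filterU pP) [].
  - move=> x Ux; apply: contrapT => NQ; apply: ZU; exists x; split=> // -[V NPV Vx].
    by apply: NQ; exists (sval V) => //; exists V.
  by apply: NPV; apply: prime_filter_le PU => //; rewrite le_qclat; exact/asboolP.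
have clZ : closed Z.
  by apply: open_closedC; apply: bigcup_open => V _; exact: proj1 (svalP V).
have Z0 : Z !=set0.
  by have [x [Zx _]] := (ZP _).1 (prime_filterT pP); exists x.
have irrZ : irreducible Z.
  (* If neither [F] nor [G] contained [Z], some members of [P] would avoid [F] and [G] respectively.
     Their meet is in [P], so it meets [Z] at a point outside both. *)
  move=> F G clF clG ZFG; apply: contrapT => /not_orP [ZF ZG].
  have sep (H : set X) : closed H -> ~ Z `<=` H ->
      exists2 U : K, sval P U & sval U `<=` ~` H.
    move=> clH /existsNP [x /not_implyP [Zx Hx]].
    have [U Ux UH] := spectral_qc_nbhs (open_nbhs_nbhs (conj (closed_openC clH) Hx)).
    by exists U => //; apply/ZP; exists x.
  have [U PU UF] := sep F clF ZF; have [V PV VG] := sep G clG ZG.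
  have /ZP [x [/ZFG FGx [/UF Fx /VG Gx]]] := (prime_filterI pP U V).2 (conj PU PV).
  by case: FGx.
have [x [clx _]] := spectral_generic sX Z0 clZ irrZ.
(* An open set meets the closure of [x] exactly when it contains [x]. *)
exists x; apply: pspec_ext => U; rewrite ZP -clx; split=> [Ux|[y [cly Uy]]].
  by exists x; split=> //; exact: subset_closure.
by move/closure1P: cly; apply=> //; exact: proj1 (svalP U).
Qed.

Definition point_inv P : X := projT1 (cid (point_fun_surj P)).

Lemma point_invK : cancel point_inv point_fun.
Proof. by move=> P; rewrite /point_inv; case: cid. Qed.

Lemma point_funK : cancel point_fun point_inv.
Proof. by move=> x; apply: point_fun_inj; exact: point_invK. Qed.

(** Once [P] is written as [point_fun] of its inverse image, both sides are convertible. Continuity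
    and spectrality of the inverse follow from this. *)
Lemma point_inv_preimage U : point_inv @^-1` sval U = basic_open U.
Proof. by apply/funext => P; rewrite -[in RHS](point_invK P). Qed.

Definition point_map : spectral_map X (pspec K).
Proof.
apply: (@spectral_map_of _ _ point_fun).
- apply/continuousP => A /pspec_openP oA.
  rewrite openE => x /= /oA [U Ux UA]; rewrite /interior nbhsE.
  exists (sval U); first by split=> //; exact: proj1 (svalP U).
  by move=> y Uy; exact: UA.
- by move=> V /qc_open_basic [U ->]; exact: proj2 (svalP U).
Defined.

Definition point_inv_map : spectral_map (pspec K) X.
Proof.
apply: (@spectral_map_of _ _ point_inv).
- apply/continuousP => A oA; apply/pspec_openP => P /= AP.
  have [U UP UA] := spectral_qc_nbhs (open_nbhs_nbhs (conj oA AP)).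
  exists U; first by rewrite -[sval P U]/(basic_open U P) -point_inv_preimage.
  by rewrite -point_inv_preimage => Q; exact: UA.
- move=> V qV; rewrite (point_inv_preimage (exist _ V qV)).
  exact: compact_basic_open.
Defined.

End PointIso.

Section StoneDuality.
Variable d : Order.disp_t.
Local Notation S := (pspec_functor d).
Local Notation K := (qclat_functor d).

Definition basic_open_iso :
  natural_iso (comp_functor K S) (id_functor (opposite (BDLat d))).
Proof.
refine (@NaturalIso (opposite (BDLat d)) (opposite (BDLat d))
  (comp_functor K S) (id_functor (opposite (BDLat d)))
  (fun L => basic_open_hom L) (fun L => basic_open_inv_hom L) _ _ _).
- by move=> L M f; apply: bdlat_hom_eq => a; exact: qcopens_ext.
- by move=> L; apply: bdlat_hom_eq => U; exact: basic_open_invK.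
- by move=> L; apply: bdlat_hom_eq => a; exact: basic_open_homK.
Defined.

Definition point_iso : natural_iso (id_functor Spec) (comp_functor S K).
Proof.
refine (@NaturalIso Spec Spec (id_functor Spec) (comp_functor S K)
  (fun X => point_map d (proj2_sig X)) (fun X => point_inv_map d (proj2_sig X)) _ _ _).
- by move=> X Y f; apply: spectral_map_eq => x; exact: pspec_ext.
- by move=> X; apply: spectral_map_eq => x; exact: point_funK.
- by move=> X; apply: spectral_map_eq => P; exact: point_invK.
Defined.

(** In the opposite category [basic_open_hom] points towards the identity, while [point_map] starts
    from it. Both are opposite to the required unit and counit, hence the inversions. *)
Definition stone_duality : equivalence (opposite (BDLat d)) Spec :=
  Equivalence (natural_iso_sym basic_open_iso) (natural_iso_sym point_iso).

End StoneDuality.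

Theorem theoremB (d : Order.disp_t) :
  (exists e : equivalence RadSemiRing (BDLat d),
     comp_functor (forget_bdlat d) (eqv_fun e) = forget_radsemiring /\
     comp_functor forget_radsemiring (eqv_inv e) = forget_bdlat d) /\
  antiequivalent (BDLat d) Spec /\
  antiequivalent RadSemiRing Spec.
Proof.
split; [|split].
- exists (radsemiring_equivalence d); split.
    exact: forget_lattice_of_semiring.
  exact: forget_semiring_of_lattice.
- exact: inhabits (stone_duality d).
- apply: inhabits; apply: equivalence_comp (stone_duality d).
  exact: opposite_equivalence (radsemiring_equivalence d).
Qed.
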